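(* Let $\mathbb{D}$ be any commutative ring with identity. Then for all positive integers $n$, the truncated Riordan group $\mathcal{R}_n$ and the truncated Lagrange group $\mathcal{L}_n$ over $\mathbb{D}$ are solvable.
   Context: Let $\mathbb{D}$ be a commutative ring with identity (possibly with zero divisors), and let $\mathbb{D}^*$ be its group of units. The Riordan group $\mathcal{R}=\mathcal{R}(\mathbb{D})$ consists of all pairs $(g(t),f(t))$ of formal power series in $\mathbb{D}[[t]]$ with $g(t)=\sum_{k\ge 0} g_kt^k$, $g_0\in\mathbb{D}^*$, and $f(t)=\sum_{k\ge 1} f_kt^k$, $f_1\in\mathbb{D}^*$, with operation $(g,f)(G,F)=\bigl(g(t)\,G(f(t)),\,F(f(t))\bigr)$ and identity $(1,t)$. The pair $(g,f)$ is identified with the infinite lower triangular matrix (Riordan array) $(d_{i,j})_{i,j\ge 0}$, $d_{i,j}=[t^i]\,g(t)f(t)^j$, where $[t^i]h(t)$ is the coefficient of $t^i$ in $h(t)$; the operation becomes matrix multiplication. The Lagrange subgroup $\mathcal{L}\le\mathcal{R}$ consists of the arrays $(1,f(t))$. For $n\ge0$ the truncation homomorphism $\Pi_n:\mathcal{R}\to \mathrm{GL}(n+1,\mathbb{D})$ is $\Pi_n\bigl((d_{i,j})_{i,j\ge0}\bigr)=(d_{i,j})_{0\le i,j\le n}$, and $\mathcal{R}_n:=\Pi_n(\mathcal{R})$, $\mathcal{L}_n:=\Pi_n(\mathcal{L})$. *)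

(* Defs.v *)
From HB Require Import structures.
From mathcomp Require Import all_boot all_order all_algebra zify.

Set Implicit Arguments.
Unset Strict Implicit.
Unset Printing Implicit Defensive.

Import GRing.Theory.
Local Open Scope ring_scope.

Section Solvability.
Local Open Scope group_scope.
Variable G : groupType.
Implicit Types H S : G -> Prop.

Definition is_subgroup H : Prop :=
  [/\ H 1, forall x y, H x -> H y -> H (x * y) & forall x, H x -> H x^-1].

Definition generated_subgroup S : G -> Prop :=
  fun x => forall H, is_subgroup H -> (forall y, S y -> H y) -> H x.

Definition derived_subgroup H : G -> Prop :=
  generated_subgroup (fun z => exists x y, [/\ H x, H y & z = commg x y]).

Definition derived_series H (m : nat) : G -> Prop := iter m derived_subgroup H.

Definition solvable_subgroup H : Prop :=
  is_subgroup H /\ exists m, forall x, derived_series H m x -> x = 1.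

End Solvability.

(* [{'GL_n[R]}] requires a finite ring and [unitmx] a decidable unit predicate;
   here a member of GL(n, D) is a matrix paired with its two-sided inverse. The
   inverse is unique, so equality in GL(n, D) is equality of matrices. *)
Section GeneralLinear.
Variables (D : comPzRingType) (n : nat).

Record GL := MkGL {
  gl_pair : 'M[D]_n * 'M[D]_n;
  gl_pairP : (gl_pair.1 *m gl_pair.2 == 1%:M) && (gl_pair.2 *m gl_pair.1 == 1%:M)
}.

HB.instance Definition _ := [isSub for gl_pair].
HB.instance Definition _ := [Choice of GL by <:].

Definition gl_mx (A : GL) : 'M[D]_n := (gl_pair A).1.
Definition gl_imx (A : GL) : 'M[D]_n := (gl_pair A).2.

Lemma gl_mxV A : gl_mx A *m gl_imx A = 1%:M.
Proof. by case/andP: (gl_pairP A) => /eqP. Qed.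

Lemma gl_Vmx A : gl_imx A *m gl_mx A = 1%:M.
Proof. by case/andP: (gl_pairP A) => _ /eqP. Qed.

Lemma gl_mx_inj : injective gl_mx.
Proof.
move=> A B AB; apply: val_inj.
rewrite [LHS]surjective_pairing [RHS]surjective_pairing; congr pair => //.
change (gl_imx A = gl_imx B).
by rewrite -[LHS]mulmx1 -(gl_mxV B) mulmxA -AB gl_Vmx mul1mx.
Qed.

Definition gl_build (A B : 'M[D]_n) (AB : A *m B = 1%:M) : GL :=
  @MkGL (A, B) (introT andP (conj (introT eqP AB) (introT eqP (mulmx1C AB)))).

Lemma gl_mul_subproof A B :
  (gl_mx A *m gl_mx B) *m (gl_imx B *m gl_imx A) = 1%:M.
Proof. by rewrite mulmxA -(mulmxA (gl_mx A)) gl_mxV mulmx1 gl_mxV. Qed.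

Definition gl_one : GL := gl_build (mul1mx 1%:M).
Definition gl_mul (A B : GL) : GL := gl_build (gl_mul_subproof A B).
Definition gl_inv (A : GL) : GL := gl_build (gl_Vmx A).

Lemma gl_mulA : associative gl_mul.
Proof. by move=> A B C; apply: gl_mx_inj; apply: mulmxA. Qed.

Lemma gl_mul1 : left_id gl_one gl_mul.
Proof. by move=> A; apply: gl_mx_inj; apply: mul1mx. Qed.

Lemma gl_mul1r : right_id gl_one gl_mul.
Proof. by move=> A; apply: gl_mx_inj; apply: mulmx1. Qed.

Lemma gl_mulV : left_inverse gl_one gl_inv gl_mul.
Proof. by move=> A; apply: gl_mx_inj; apply: gl_Vmx. Qed.

Lemma gl_mulVr : right_inverse gl_one gl_inv gl_mul.
Proof. by move=> A; apply: gl_mx_inj; apply: gl_mxV. Qed.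

HB.instance Definition _ :=
  isGroup.Build GL gl_mulA gl_mul1 gl_mul1r gl_mulV gl_mulVr.

End GeneralLinear.

Definition is_unit (D : comPzRingType) (a : D) : Prop := exists b, b * a = 1.

Section PowerSeries.
Variable D : comPzRingType.

(* [a : fps] is the series \sum_k a k * t^k. *)
Definition fps := nat -> D.

Definition fps_one : fps := fun k => (k == 0%N)%:R.

Definition fps_mul (a b : fps) : fps :=
  fun i => \sum_(k < i.+1) a k * b (i - k)%N.

Definition fps_exp (a : fps) (j : nat) : fps := iter j (fps_mul a) fps_one.

End PowerSeries.

(* Only the carrier of the Riordan group is given: its law
   (g, f) (G, F) = (g G(f), F(f)) is the product of arrays, so the truncated
   groups inherit their law from GL, and that they are subgroups is part of
   [solvable_subgroup]. *)
Record riordan (D : comPzRingType) := Riordan {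
  rg : fps D;
  rf : fps D;
  rg_unit : is_unit (rg 0%N);
  rf_zero : rf 0%N = 0;
  rf_unit : is_unit (rf 1%N)
}.

Definition lagrange (D : comPzRingType) (x : riordan D) : Prop :=
  forall k, rg x k = fps_one D k.

Definition riordan_array (D : comPzRingType) (x : riordan D) (i j : nat) : D :=
  fps_mul (rg x) (fps_exp (rf x) j) i.

Section Truncation.
Variables (D : comPzRingType) (n : nat).

Definition truncation_mx (x : riordan D) : 'M[D]_n.+1 :=
  \matrix_(i, j) riordan_array x i j.

Lemma fps_exp_low (f : fps D) j i :
  f 0%N = 0 -> (i < j)%N -> fps_exp f j i = 0.
Proof.
move=> f0; elim: j i => [//|j IHj] i lt_ij.
rewrite /fps_exp iterS -/(fps_exp f j) /fps_mul big_ord_recl f0 mul0r add0r.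
rewrite big1 // => k _; rewrite lift0 IHj ?mulr0 //.
by have := ltn_ord k; lia.
Qed.

Lemma fps_exp_diag (f : fps D) j : f 0%N = 0 -> fps_exp f j j = f 1%N ^+ j.
Proof.
move=> f0; elim: j => [//|j IHj].
rewrite /fps_exp iterS -/(fps_exp f j) /fps_mul !big_ord_recl f0 mul0r add0r.
rewrite big1 ?addr0 => [|k _]; last first.
  by rewrite !lift0 fps_exp_low ?mulr0 //; have := ltn_ord k; lia.
by rewrite lift0 subn1 IHj exprS.
Qed.

Lemma riordan_array_low (x : riordan D) i j :
  (i < j)%N -> riordan_array x i j = 0.
Proof.
move=> lt_ij; rewrite /riordan_array /fps_mul big1 // => k _.
by rewrite fps_exp_low ?mulr0 ?rf_zero // (leq_ltn_trans (leq_subr _ _)).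
Qed.

Lemma riordan_array_diag (x : riordan D) i :
  riordan_array x i i = rg x 0%N * rf x 1%N ^+ i.
Proof.
rewrite /riordan_array /fps_mul big_ord_recl subn0 fps_exp_diag ?rf_zero //.
rewrite big1 ?addr0 // => k _; rewrite lift0 fps_exp_low ?mulr0 ?rf_zero //.
by have := ltn_ord k; lia.
Qed.

Lemma truncation_det_unit (x : riordan D) :
  exists u, \det (truncation_mx x) * u == 1.
Proof.
have [[u Hu] [v Hv]] := (rg_unit x, rf_unit x).
exists (\prod_(i < n.+1) (u * v ^+ i)).
rewrite det_trig; last first.
  by apply/is_trig_mxP => i j lt_ij; rewrite mxE riordan_array_low.
rewrite -big_split big1 // => i _.
by rewrite /= mxE riordan_array_diag mulrACA -exprMn
           [rg x 0%N * u]mulrC [rf x 1%N * v]mulrC Hu Hv expr1n mulr1.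
Qed.

Lemma truncation_subproof (x : riordan D) :
  truncation_mx x *m
    (xchoose (truncation_det_unit x) *: \adj (truncation_mx x)) = 1%:M.
Proof.
rewrite -scalemxAr mul_mx_adj scale_scalar_mx mulrC.
by rewrite (eqP (xchooseP (truncation_det_unit x))).
Qed.

Definition truncation (x : riordan D) : GL D n.+1 :=
  gl_build (truncation_subproof x).

Lemma gl_mx_truncation x : gl_mx (truncation x) = truncation_mx x.
Proof. by []. Qed.

Definition truncated_riordan : GL D n.+1 -> Prop :=
  fun A => exists x : riordan D, A = truncation x.

Definition truncated_lagrange : GL D n.+1 -> Prop :=
  fun A => exists x : riordan D, lagrange x /\ A = truncation x.

End Truncation.

Arguments truncated_riordan D n _ : clear implicits.
Arguments truncated_lagrange D n _ : clear implicits.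

(* Main.v *)
Require Import Defs.
From mathcomp Require Import all_boot all_order all_algebra.
From mathcomp Require Import zify.

Set Implicit Arguments.
Unset Strict Implicit.
Unset Printing Implicit Defensive.

Import GRing.Theory.
Local Open Scope ring_scope.

(** The truncated Riordan group consists of invertible lower triangular
    matrices, and the group of these is solvable: the matrices congruent to 1
    modulo the matrices supported on the [k]-th subdiagonal and below form a
    descending chain of subgroups [U_k], with [U_k, U_k] contained in
    [U_(k+1)] ([depth_gl_comm]) and [U_(n+1)] trivial.  Indeed, if [E = 1 + X]
    and [F = 1 + Y], then [E^-1 F^-1 E F - 1 = E^-1 F^-1 (X Y - Y X)]; at
    [k = 0] the depth increases because diagonal entries commute.

    It remains to see that the truncated arrays do form a subgroup of GL.  Let
    [N] be the nilpotent shift matrix, which represents multiplication by [t]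
    on series modulo [t^(n+1)].  The matrices commuting with [N] are the
    polynomials in [N], that is, the Toeplitz matrices [toeplitz a], which
    represent multiplication by the series [a].  Each column of the array [A]
    of [(g, f)] is the preceding one multiplied by [f], which says that
    [A N = toeplitz f A]; this relation and the first column, [g], determine
    [A].  Hence, for [n > 0] and among the invertible lower triangular matrices
    with lower triangular inverse, the truncated arrays are the [A] such that
    [A N A^-1] commutes with [N] ([truncated_riordanP]); the Lagrange arrays
    moreover fix the series 1 ([truncated_lagrangeP]).  Both conditions
    are visibly stable under products and inverses: if [B N B^-1] is a
    polynomial in [N], then [A B N B^-1 A^-1] is the same polynomial in
    [A N A^-1]; and conjugation by [A^-1] turns the commutation of [A N A^-1]
    with [N] into that of [N] with [A^-1 N A].  Thus neither composition nor
    reversion of power series is needed. *)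

(** * Solvability from a descending chain *)

Section DerivedSeries.
Variable G : groupType.
Implicit Types (H K : G -> Prop) (U : nat -> G -> Prop).

Lemma derived_subgroup_min H K : is_subgroup K ->
  (forall x y, H x -> H y -> K (commg x y)) ->
  forall z, derived_subgroup H z -> K z.
Proof. by move=> sgK HK z; apply=> // _ [x [y [Hx Hy ->]]]; apply: HK. Qed.

(** The derived series of [H] descends at least as fast as any chain [U] of
    subgroups that starts above [H] and has [U k, U k] inside [U k.+1]. *)
Lemma solvable_of_chain H U n : is_subgroup H ->
    (forall x, H x -> U 0%N x) -> (forall k, is_subgroup (U k)) ->
    (forall k x y, U k x -> U k y -> U k.+1 (commg x y)) ->
    (forall x, U n x -> x = 1%g) ->
  solvable_subgroup H.
Proof.
move=> sgH HU0 sgU UR Un; split=> //; exists n => x Hx; apply: Un.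
elim: n x Hx => [|m IHm] x; first exact: HU0.
rewrite /derived_series iterS -/(derived_series H m).
by apply: derived_subgroup_min => // y z /IHm Uy /IHm Uz; apply: UR.
Qed.

Lemma eq_is_subgroup H K :
  (forall x, K x <-> H x) -> is_subgroup H -> is_subgroup K.
Proof.
move=> KH [H1 HM HV]; split=> [|x y|x]; rewrite !KH //; first exact: HM.
exact: HV.
Qed.

Lemma is_subgroupI H K :
  is_subgroup H -> is_subgroup K -> is_subgroup (fun x => H x /\ K x).
Proof.
move=> [H1 HM HV] [K1 KM KV]; split=> [|x y [Hx Kx] [Hy Ky]|x [Hx Kx]] //.
  by split; [apply: HM|apply: KM].
by split; [apply: HV|apply: KV].
Qed.

End DerivedSeries.

(** * The depth filtration on square matrices *)

Section Depth.
Variables (D : comPzRingType) (n : nat).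
Implicit Types A B X Y : 'M[D]_n.

Lemma mulrmxE A B i j : (A * B) i j = \sum_k A i k * B k j.
Proof. exact: mxE. Qed.

Lemma onemxE i j : (1 : 'M[D]_n) i j = (i == j)%:R.
Proof. exact: mxE. Qed.

(** [A] has depth [k] when its entries vanish above the [k]-th subdiagonal:
    depth 0 is lower triangular, depth 1 is strictly lower triangular. *)
Definition depth k A := forall i j : 'I_n, (i < j + k)%N -> A i j = 0.

Lemma depthW k l A : (l <= k)%N -> depth k A -> depth l A.
Proof. by move=> le_lk dA i j lt_ij; apply: dA; lia. Qed.

Lemma depth_mx0 k : depth k 0.
Proof. by move=> i j _; rewrite mxE. Qed.

Lemma depth_mx1 : depth 0 1.
Proof.
by move=> i j; rewrite onemxE; case: eqP => // ->; rewrite addn0 ltnn.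
Qed.

Lemma depthD k A B : depth k A -> depth k B -> depth k (A + B).
Proof. by move=> dA dB i j lt_ij; rewrite mxE dA ?dB ?addr0. Qed.

Lemma depthN k A : depth k A -> depth k (- A).
Proof. by move=> dA i j lt_ij; rewrite mxE dA ?oppr0. Qed.

Lemma depthM k l A B : depth k A -> depth l B -> depth (k + l) (A * B).
Proof.
move=> dA dB i j lt_ij; rewrite mulrmxE big1 // => m _.
have [lt_im|le_mi] := ltnP i (m + k); first by rewrite dA ?mul0r.
by rewrite dB ?mulr0 //; lia.
Qed.

(** The entries on the leading subdiagonal of a product are single products. *)
Lemma depthM_lead k l A B (i m j : 'I_n) : depth k A -> depth l B ->
  i = (m + k)%N :> nat -> m = (j + l)%N :> nat ->
  (A * B) i j = A i m * B m j.
Proof.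
move=> dA dB im mj; rewrite mulrmxE (bigD1 m) //= big1 ?addr0 // => m' neq_m'm.
have [lt_mm'|le_m'm] := ltnP m m'; first by rewrite dA ?mul0r //; lia.
rewrite dB ?mulr0 //; move/eqP: neq_m'm => neq_m'm.
by have: nat_of_ord m' <> m by [move/val_inj]; lia.
Qed.

Lemma depth_eq0 A : depth n A -> A = 0.
Proof.
move=> dA; apply/matrixP=> i j; rewrite mxE dA //.
by have := ltn_ord i; lia.
Qed.

(** At depth 0 the diagonals commute; at positive depth the depths add up. *)
Lemma depth_comm k X Y :
  depth k X -> depth k Y -> depth k.+1 (X * Y - Y * X).
Proof.
case: k => [|k] dX dY; last first.
  apply: (@depthW (k.+1 + k.+1)); first by lia.
  by apply: depthD; [|apply: depthN]; apply: depthM.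
move=> i j; rewrite addn1 ltnS leq_eqVlt => /orP[/eqP/val_inj <-|lt_ij].
  have -> : (X * Y - Y * X) i i = (X * Y) i i - (Y * X) i i by rewrite !mxE.
  by rewrite !(@depthM_lead 0 0 _ _ i i i) ?addn0 // mulrC subrr.
have le0 Z : depth 0 Z -> Z i j = 0 by apply; rewrite addn0.
by apply: le0; apply: depthD; [|apply: depthN]; apply: (@depthM 0 0).
Qed.

(** A right inverse of a lower triangular matrix whose diagonal entries are
    units is lower triangular. *)
Lemma depth_inv A B : (forall i, is_unit (A i i)) -> depth 0 A -> A * B = 1 ->
  depth 0 B.
Proof.
move=> uA dA AB i j; rewrite addn0.
have [m] := ubnP (nat_of_ord i).
elim: m i => // m IHm i; rewrite ltnS => le_im lt_ij.
have [u uAii] := uA i.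
have: (A * B) i j = 0.
  by rewrite AB onemxE; case: eqP => // eq_ij; rewrite eq_ij ltnn in lt_ij.
rewrite mulrmxE (bigD1 i) //= big1 => [|k neq_ki].
  by rewrite addr0 => AB0; rewrite -[B i j]mul1r -uAii -mulrA AB0 mulr0.
have [lt_ik|le_ki] := ltnP i k; first by rewrite dA ?mul0r // addn0.
have lt_ki : (k < i)%N by rewrite ltn_neqAle le_ki andbT.
by rewrite IHm ?mulr0 //; lia.
Qed.

End Depth.

(** * The depth filtration on the general linear group *)

Section UnitriangularChain.
Variables (D : comPzRingType) (n : nat).
Implicit Types A B : GL D n.

(** The invertible matrices congruent to 1 modulo depth [k], together with
    their inverses: the invertible lower triangular matrices for [k = 0], the
    congruence subgroups of unitriangular matrices for [k > 0]. *)
Definition depth_gl k A := depth k (gl_mx A - 1) /\ depth k (gl_imx A - 1).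

Lemma gl_mx1 : gl_mx (1%g : GL D n) = 1. Proof. by []. Qed.
Lemma gl_imx1 : gl_imx (1%g : GL D n) = 1. Proof. by []. Qed.
Lemma gl_mxM A B : gl_mx (A * B)%g = gl_mx A * gl_mx B. Proof. by []. Qed.
Lemma gl_imxM A B : gl_imx (A * B)%g = gl_imx B * gl_imx A. Proof. by []. Qed.
Lemma gl_mxI A : gl_mx (A^-1)%g = gl_imx A. Proof. by []. Qed.
Lemma gl_imxI A : gl_imx (A^-1)%g = gl_mx A. Proof. by []. Qed.

Lemma gl_mulrV A : gl_mx A * gl_imx A = 1. Proof. exact: gl_mxV. Qed.
Lemma gl_mulVr A : gl_imx A * gl_mx A = 1. Proof. exact: gl_Vmx. Qed.

Lemma depth_glP A :
  depth_gl 0 A <-> depth 0 (gl_mx A) /\ depth 0 (gl_imx A).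
Proof.
suff d1 (X : 'M[D]_n) : depth 0 (X - 1) <-> depth 0 X.
  by rewrite /depth_gl !d1.
split=> dX; last by apply: depthD => //; apply: depthN; apply: depth_mx1.
by rewrite -(subrK 1 X); apply: depthD => //; apply: depth_mx1.
Qed.

Lemma depth0_subr1 k (X : 'M[D]_n) : depth k (X - 1) -> depth 0 X.
Proof.
move=> dX; rewrite -(subrK 1 X); apply: depthD; last exact: depth_mx1.
exact: depthW dX.
Qed.

Lemma depth_subr1M k (X Y : 'M[D]_n) :
  depth k (X - 1) -> depth k (Y - 1) -> depth k (X * Y - 1).
Proof.
move=> dX dY; rewrite -(subrKA Y) -{2}[Y]mul1r -mulrBl; apply: depthD => //.
by rewrite -[k]addn0; apply: depthM => //; apply: depth0_subr1 dY.
Qed.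

Lemma is_subgroup_depth_gl k : is_subgroup (depth_gl k).
Proof.
split=> [|A B [dA dA'] [dB dB']|A [dA dA']]; last by split.
  by rewrite /depth_gl gl_mx1 gl_imx1 subrr; split; apply: depth_mx0.
by rewrite /depth_gl gl_mxM gl_imxM; split; apply: depth_subr1M.
Qed.

Lemma gl_mx_commg A B :
  gl_mx (commg A B) = gl_imx A * gl_imx B * gl_mx A * gl_mx B.
Proof. by rewrite -!mulrA. Qed.

Lemma gl_imx_commg A B : gl_imx (commg A B) = gl_mx (commg B A).
Proof. by rewrite gl_mx_commg. Qed.

Lemma depth_gl_comm k A B :
  depth_gl k A -> depth_gl k B -> depth_gl k.+1 (commg A B).
Proof.
suff dR E F :
  depth_gl k E -> depth_gl k F -> depth k.+1 (gl_mx (commg E F) - 1).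
  by move=> dA dB; split; rewrite ?gl_imx_commg; apply: dR.
move=> [dE dE'] [dF dF'].
set X := gl_mx E - 1 in dE; set Y := gl_mx F - 1 in dF.
have -> : gl_mx (commg E F) - 1 = gl_imx E * gl_imx F * (X * Y - Y * X).
  have -> : X * Y - Y * X = gl_mx E * gl_mx F - gl_mx F * gl_mx E.
    have expand (a b : 'M[D]_n) : (a - 1) * (b - 1) = a * b - (a + (b - 1)).
      by rewrite mulrBl mulrBr mulr1 mul1r -addrA -opprD.
    by rewrite !expand (addrCA (gl_mx F)) opprB subrKA.
  rewrite gl_mx_commg mulrBr !mulrA; congr (_ - _).
  by rewrite -[_ * gl_mx F]mulrA gl_mulVr mulr1 gl_mulVr.
apply: (@depthM _ _ 0 k.+1); last exact: depth_comm.
by apply: (@depthM _ _ 0 0); apply: depth0_subr1; eassumption.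
Qed.

Lemma depth_gl_eq1 A : depth_gl n A -> A = 1%g.
Proof.
by case=> /depth_eq0/eqP; rewrite subr_eq0 => /eqP A1 _; apply: gl_mx_inj.
Qed.

Lemma solvable_lower_triangular (H : GL D n -> Prop) :
  is_subgroup H -> (forall A, H A -> depth_gl 0 A) -> solvable_subgroup H.
Proof.
move=> sgH H0; apply: (solvable_of_chain sgH H0 is_subgroup_depth_gl).
  exact: depth_gl_comm.
exact: depth_gl_eq1.
Qed.

End UnitriangularChain.

(** * Toeplitz matrices *)

Section Toeplitz.
Variables (D : comPzRingType) (n : nat).
Implicit Types (a b : fps D) (M : 'M[D]_n.+1).

(** Multiplication by [t] on series modulo [t^(n+1)]. *)
Definition shift : 'M[D]_n.+1 := \matrix_(i, j) (i == j.+1 :> nat)%:R.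

Lemma shift_expE k (i j : 'I_n.+1) :
  (shift ^+ k) i j = (i == (j + k)%N :> nat)%:R.
Proof.
elim: k i => [|k IHk] i; first by rewrite expr0 onemxE addn0.
rewrite exprS mulrmxE; have [lt_jkn|le_njk] := ltnP (j + k)%N n.+1; last first.
  rewrite big1 => [|m _]; first by case: eqP => // eq_i; have := ltn_ord i; lia.
  by rewrite IHk; case: (_ =P (_ + _)%N) => [eq_m|_]; rewrite ?mulr0 //;
     have := ltn_ord m; lia.
rewrite (bigD1 (Ordinal lt_jkn)) //= big1 => [|m neq_m].
  by rewrite IHk mxE /= eqxx mulr1 addr0 addnS.
rewrite IHk; case: eqP => [eq_m|_]; rewrite ?mulr0 //.
by case/eqP: neq_m; apply: val_inj.
Qed.

(** Column [j] is the first column of the product with the [j]-th power of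
    the shift. *)
Lemma mul_shift_expr0 M (i j : 'I_n.+1) : (M * shift ^+ j) i ord0 = M i j.
Proof.
rewrite mulrmxE (bigD1 j) //= big1 => [|m neq_m].
  by rewrite shift_expE add0n eqxx mulr1 addr0.
rewrite shift_expE add0n; case: eqP => [/val_inj eq_m|_]; rewrite ?mulr0 //.
by rewrite eq_m eqxx in neq_m.
Qed.

Lemma depth_shift : depth 1 shift.
Proof.
move=> i j lt_ij; rewrite -[shift]expr1 shift_expE; case: eqP => // eq_ij.
by rewrite eq_ij ltnn in lt_ij.
Qed.

(** Multiplication by the series [a] modulo [t^(n+1)]. *)
Definition toeplitz a : 'M[D]_n.+1 := \sum_(k < n.+1) (a k)%:M * shift ^+ k.

Lemma comm_shift_toeplitz a : GRing.comm shift (toeplitz a).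
Proof.
apply: commr_sum => k _; apply: commrM; last exact/commrX/commr_refl.
by rewrite -comm_mxE; apply: comm_mx_scalar.
Qed.

Lemma scalar_mulrmxE (c : D) M i j : (c%:M * M) i j = c * M i j.
Proof. by rewrite -mulmxE mul_scalar_mx mxE. Qed.

Lemma toeplitzE a (i j : 'I_n.+1) :
  toeplitz a i j = if (j <= i)%N then a (i - j)%N else 0.
Proof.
rewrite /toeplitz summxE; case: leqP => [le_ji|lt_ij]; last first.
  rewrite big1 // => k _; rewrite scalar_mulrmxE shift_expE.
  by case: eqP => [eq_i|_]; rewrite ?mulr0 //; lia.
have lt_ijn : (i - j < n.+1)%N by apply: leq_ltn_trans (leq_subr _ _) _.
rewrite (bigD1 (Ordinal lt_ijn)) //= big1 => [|k neq_k].
  by rewrite scalar_mulrmxE shift_expE subnKC // eqxx mulr1 addr0.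
rewrite scalar_mulrmxE shift_expE; case: eqP => [eq_i|_]; rewrite ?mulr0 //.
by case/eqP: neq_k; apply: val_inj; rewrite /= eq_i addKn.
Qed.

Lemma toeplitz_col0 a (i : 'I_n.+1) : toeplitz a i ord0 = a i.
Proof. by rewrite toeplitzE subn0. Qed.

(** A matrix commuting with the shift is the Toeplitz matrix of its first
    column. *)
Lemma comm_shift_eq M a : GRing.comm shift M ->
  (forall i, M i ord0 = a i) -> M = toeplitz a.
Proof.
move=> cM Ma; apply/matrixP=> i j.
have entryE P : GRing.comm shift P ->
  P i j = \sum_m (shift ^+ j) i m * P m ord0.
  by move=> cP; rewrite -mulrmxE -mul_shift_expr0 (commrX _ (commr_sym cP)).
rewrite !entryE //; last exact: comm_shift_toeplitz.
by apply: eq_bigr => m _; rewrite toeplitz_col0 Ma.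
Qed.

Lemma comm_toeplitz M a : GRing.comm M shift -> GRing.comm M (toeplitz a).
Proof.
move=> cM; apply: commr_sum => k _; apply: commrM; last exact: commrX.
by rewrite -comm_mxE; apply: comm_mx_scalar.
Qed.

Lemma toeplitz_comm a b : GRing.comm (toeplitz a) (toeplitz b).
Proof. apply: comm_toeplitz; apply: commr_sym; exact: comm_shift_toeplitz. Qed.

Lemma toeplitz1 : toeplitz (fps_one D) = 1.
Proof.
by symmetry; apply: comm_shift_eq => [|i]; [apply: commr1|rewrite onemxE].
Qed.

Lemma toeplitzM a b : toeplitz (fps_mul a b) = toeplitz a * toeplitz b.
Proof.
symmetry; apply: comm_shift_eq => [|i].
  exact: commrM (comm_shift_toeplitz _) (comm_shift_toeplitz _).
rewrite toeplitz_comm mulrmxE /fps_mul.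
rewrite (big_ord_widen n.+1 (fun k => a k * b (i - k)%N)) //.
rewrite [RHS]big_mkcond; apply: eq_bigr => k _.
by rewrite toeplitz_col0 toeplitzE ltnS; case: ifP; rewrite ?mul0r // mulrC.
Qed.

Lemma toeplitzX a j : toeplitz (fps_exp a j) = toeplitz a ^+ j.
Proof.
elim: j => [|j IHj]; first by rewrite expr0 -toeplitz1.
by rewrite /fps_exp iterS -/(fps_exp a j) toeplitzM IHj exprS.
Qed.

End Toeplitz.

(** * The truncated Riordan and Lagrange groups inside GL *)

Section RiordanConjugation.
Variables (D : comPzRingType) (n : nat).
Implicit Types (A B : GL D n.+1) (x : riordan D).

Let N : 'M[D]_n.+1 := shift D n.

(** Conjugate of the shift by [A]. *)
Definition conj_shift A : 'M[D]_n.+1 := gl_mx A * N * gl_imx A.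

(** The invertible lower triangular matrices, with lower triangular inverse,
    that conjugate the shift to a matrix commuting with the shift: for
    [n > 0] this is the truncated Riordan group. *)
Definition normalizes_shift A : Prop :=
  depth_gl 0 A /\ GRing.comm (conj_shift A) N.

(** Column [j] of the array is the series [f^j g]. *)
Lemma riordan_arrayE x (i : 'I_n.+1) j :
  riordan_array x i j =
  (toeplitz n (rf x) ^+ j * toeplitz n (rg x)) i ord0.
Proof.
rewrite /riordan_array -(toeplitz_col0 (fps_mul _ _)) toeplitzM toeplitzX.
by rewrite (commrX _ (toeplitz_comm _ _ _)).
Qed.

Lemma depth_truncation x : depth_gl 0 (truncation n x).
Proof.
apply/depth_glP; have d0 : depth 0 (gl_mx (truncation n x)).
  by move=> i j; rewrite addn0 mxE; apply: riordan_array_low.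
split=> //; apply: depth_inv d0 (gl_mulrV _) => i.
rewrite mxE riordan_array_diag.
have [[u ug] [v vf]] := (rg_unit x, rf_unit x).
by exists (u * v ^+ i); rewrite mulrACA ug mul1r -exprMn vf expr1n.
Qed.

(** Each column of a Riordan array is the preceding one multiplied by [f]. *)
Lemma truncation_shift x :
  gl_mx (truncation n x) * N = toeplitz n (rf x) * gl_mx (truncation n x).
Proof.
set A := gl_mx _; set F := toeplitz n (rf x).
apply/matrixP=> i j; transitivity (riordan_array x i j.+1).
  have [lt_jn|le_nj] := ltnP j.+1 n.+1; last first.
    rewrite riordan_array_low; last by have := ltn_ord i; lia.
    rewrite mulrmxE big1 // => m _; rewrite [N _ _]mxE.
    by case: eqP => [eq_m|_]; rewrite ?mulr0 //; have := ltn_ord m; lia.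
  have -> : riordan_array x i j.+1 = A i (Ordinal lt_jn) by rewrite mxE.
  by rewrite -[LHS]mul_shift_expr0 -[RHS]mul_shift_expr0 -mulrA -exprS.
rewrite riordan_arrayE exprS -mulrA mulrmxE -/F [RHS]mulrmxE.
by apply: eq_bigr => m _; rewrite [A _ _]mxE riordan_arrayE.
Qed.

Lemma conj_shift_truncation x : conj_shift (truncation n x) = toeplitz n (rf x).
Proof. by rewrite /conj_shift truncation_shift -mulrA gl_mulrV mulr1. Qed.

Lemma normalizes_shift_truncation x : normalizes_shift (truncation n x).
Proof.
split; first exact: depth_truncation.
by rewrite conj_shift_truncation; apply/commr_sym/comm_shift_toeplitz.
Qed.

Lemma gl_mx_shiftX A k : gl_mx A * N ^+ k = conj_shift A ^+ k * gl_mx A.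
Proof.
elim: k => [|k IHk]; first by rewrite !expr0 mulr1 mul1r.
by rewrite exprSr mulrA IHk exprSr -!mulrA gl_mulVr mulr1.
Qed.

(** The Riordan pair is recovered from [A] by taking for [g] the first column
    of [A], and for [f] the first column of the conjugated shift.  The series
    [g] is cut at degree [n], so that it is exactly 1 when the first column of
    [A] is that of the identity. *)
Lemma normalizes_shift_riordan A : (0 < n)%N -> normalizes_shift A ->
  exists2 x, A = truncation n x &
    forall k, rg x k = if (k <= n)%N then gl_mx A (inord k) ord0 else 0.
Proof.
move=> n_gt0 [/depth_glP[dA dB] cP].
pose i1 : 'I_n.+1 := inord 1; have i1E : i1 = 1%N :> nat by rewrite inordK.
pose g : fps D := fun k => if (k <= n)%N then gl_mx A (inord k) ord0 else 0.
(* Beyond degree [n] the coefficients of [f] are irrelevant: [inord] is then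
   [ord0]. *)
pose f : fps D := fun k => conj_shift A (inord k) ord0.
have diag (i : 'I_n.+1) : gl_mx A i i * gl_imx A i i = 1.
  rewrite -(@depthM_lead _ _ 0 0 _ _ i i i dA dB) ?addn0 //.
  by rewrite gl_mulrV onemxE eqxx.
have dAN : depth 1 (gl_mx A * N).
  by apply: (@depthM _ _ 0 1) dA (@depth_shift _ _).
have inord0 : inord 0 = ord0 :> 'I_n.+1 by apply: val_inj; rewrite /= inordK.
have g_unit : is_unit (g 0%N).
  by exists (gl_imx A ord0 ord0); rewrite /g inord0 mulrC diag.
have f0 : f 0%N = 0.
  by rewrite /f inord0; apply: (@depthM _ _ 1 0).
(* The subdiagonal entry of [A N A^-1] in column 0 is [A 1 1 * A^-1 0 0]. *)
have f_unit : is_unit (f 1%N).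
  exists (gl_mx A ord0 ord0 * gl_imx A i1 i1).
  rewrite /f -/i1 /conj_shift.
  rewrite (@depthM_lead _ _ 1 0 _ _ i1 ord0 ord0 dAN dB) ?addn0 //.
  rewrite (@depthM_lead _ _ 0 1 _ _ i1 i1 ord0 dA (@depth_shift _ _)) ?addn0 //.
  rewrite mxE i1E eqxx mulr1 [X in _ * X]mulrC mulrACA diag.
  by rewrite mul1r mulrC diag.
exists (Riordan g_unit f0 f_unit) => //; apply: gl_mx_inj.
have Pf : conj_shift A = toeplitz n f.
  by apply: comm_shift_eq => [|i]; [apply: commr_sym|rewrite /f inord_val].
apply/matrixP=> i j; rewrite mxE riordan_arrayE /= -Pf.
rewrite -mul_shift_expr0 gl_mx_shiftX !mulrmxE.
by apply: eq_bigr => m _; rewrite toeplitz_col0 /g -ltnS ltn_ord inord_val.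
Qed.

Lemma is_subgroup_normalizes_shift : is_subgroup normalizes_shift.
Proof.
have [d1 dM dV] := is_subgroup_depth_gl D n.+1 0.
split=> [|A B [dA cA] [dB cB]|A [dA cA]]; split; auto.
- by rewrite /conj_shift gl_mx1 gl_imx1 mulr1 mul1r; apply: commr_refl.
- rewrite /conj_shift gl_mxM gl_imxM.
  (* The conjugate of the shift by [B] is a polynomial in the shift, so
     conjugating it by [A] gives a polynomial in the conjugate by [A]. *)
  pose q := fun k => conj_shift B (inord k) ord0.
  have Bq : gl_mx B * N * gl_imx B = toeplitz n q.
    by apply: comm_shift_eq => [|i]; [apply: commr_sym|rewrite /q inord_val].
  have -> : gl_mx A * gl_mx B * N * (gl_imx B * gl_imx A) =
      \sum_(k < n.+1) (q k)%:M * conj_shift A ^+ k.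
    rewrite -!mulrA (mulrA (gl_mx B)) (mulrA (gl_mx B * N)) Bq mulrA.
    rewrite /toeplitz mulr_sumr mulr_suml; apply: eq_bigr => k _.
    have cq : GRing.comm (gl_mx A) (q k)%:M.
      by rewrite -comm_mxE; apply: comm_mx_scalar.
    rewrite mulrA cq -!mulrA (mulrA _ _ (gl_imx A)) gl_mx_shiftX.
    by rewrite -mulrA gl_mulrV mulr1.
  apply/commr_sym/commr_sum => k _; apply: commrM; last exact/commrX/commr_sym.
  by rewrite -comm_mxE; apply: comm_mx_scalar.
- (* Conjugation by [A] exchanges the two commutation relations. *)
  rewrite /conj_shift gl_mxI gl_imxI.
  have expand X Y : gl_imx A * (X * Y) * gl_mx A =
      (gl_imx A * X * gl_mx A) * (gl_imx A * Y * gl_mx A).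
    by rewrite -!mulrA (mulrA (gl_mx A)) gl_mulrV mul1r.
  have PN : gl_imx A * conj_shift A * gl_mx A = N.
    by rewrite /conj_shift -!mulrA gl_mulVr mulr1 mulrA gl_mulVr mul1r.
  by rewrite /GRing.comm -{2 3}PN -!expand cA.
Qed.

Lemma truncated_riordanP A : (0 < n)%N ->
  truncated_riordan D n A <-> normalizes_shift A.
Proof.
move=> n_gt0; split=> [[x ->]|/(normalizes_shift_riordan n_gt0)[x -> _]].
  exact: normalizes_shift_truncation.
by exists x.
Qed.

(** [A] fixes the constant series 1. *)
Definition fixes_one A : Prop :=
  gl_mx A *m delta_mx ord0 ord0 = delta_mx ord0 ord0 :> 'cV[D]_n.+1.

Lemma fixes_oneP A :
  fixes_one A <-> forall i : 'I_n.+1, gl_mx A i ord0 = fps_one D i.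
Proof.
rewrite /fixes_one -colE; split=> [/matrixP A0 i|A0].
  by have := A0 i ord0; rewrite !mxE andbT.
by apply/matrixP=> i j; rewrite !mxE A0 ord1 eqxx andbT.
Qed.

Lemma is_subgroup_fixes_one : is_subgroup fixes_one.
Proof.
split=> [|A B A1 B1|A A1]; rewrite /fixes_one.
- by rewrite gl_mx1 mul1mx.
- by rewrite gl_mxM -mulmxA B1 A1.
- by rewrite gl_mxI -{1}A1 mulmxA gl_Vmx mul1mx.
Qed.

Lemma truncated_lagrangeP A : (0 < n)%N ->
  truncated_lagrange D n A <-> normalizes_shift A /\ fixes_one A.
Proof.
move=> n_gt0.
split=> [[x [Lx ->]]|[/(normalizes_shift_riordan n_gt0)[x Ax gx]]].
  split; first exact: normalizes_shift_truncation.
  apply/fixes_oneP=> i.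
  by rewrite mxE riordan_arrayE expr0 mul1r toeplitz_col0 Lx.
move/fixes_oneP=> A1; exists x; split=> // k; rewrite gx.
case: leqP => [le_kn|]; first by rewrite A1 inordK.
by rewrite /fps_one; case: k.
Qed.

End RiordanConjugation.

Theorem mainTheorem4 (D : comPzRingType) (n : nat) (n_gt0 : (0 < n)%N) :
  solvable_subgroup (truncated_riordan D n) /\
  solvable_subgroup (truncated_lagrange D n).
Proof.
have sgN := is_subgroup_normalizes_shift D n.
split; apply: solvable_lower_triangular => [|A].
- exact: eq_is_subgroup (fun A => truncated_riordanP A n_gt0) sgN.
- by case/(truncated_riordanP _ n_gt0).
- apply: eq_is_subgroup (fun A => truncated_lagrangeP A n_gt0) _.
  exact: is_subgroupI sgN (is_subgroup_fixes_one D n).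
- by case/(truncated_lagrangeP _ n_gt0)=> [[]].
Qed.
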